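(* Let $n\ge 1$ be an integer, let $\mathcal B$ be a body manifold, and let ${\mathcal Z}_i \rightrightarrows {\mathcal B}$ $(i=1,\dots,n)$ be subgroupoids of the 1-jet groupoid of $\mathcal B$. Let $\tilde{\mathcal Z}$ be the set of all objective $n$-skeletons arising from ${\mathcal Z}_1,\dots,{\mathcal Z}_n$, and let ${\mathcal T}_n\in\tilde{\mathcal Z}$. Then the total weight of every circuit in ${\mathcal T}_n$ is trivial (i.e. equal to the identity at the initial vertex of the circuit) if, and only if, every 2-face of ${\mathcal T}_n$ is commutative.
   Context: A body manifold $\mathcal B$ is a smooth 3-dimensional manifold. The 1-jet groupoid of $\mathcal B$ is the groupoid with object set $\mathcal B$ whose arrows from $X$ to $Y$ are the 1-jets at $X$ of local diffeomorphisms from a neighbourhood of $X$ to a neighbourhood of $Y$ sending $X$ to $Y$. Equivalently, they are the linear isomorphisms $T_X{\mathcal B}\to T_Y{\mathcal B}$ (elements of $GL(3,{\mathbb R})$ in a chart), composed as maps. Each ${\mathcal Z}_i$ is a subgroupoid of it with the same object set $\mathcal B$. The oriented $n$-skeleton $S_n$ is the directed graph with vertex set $\{0,1\}^n$ and, for each $I\in\{1,\dots,n\}$ and each vertex $v$ with $v_I=0$, one oriented edge from $v$ to $v+e_I$, called an $X_I$-edge, where $e_I$ is the $I$-th standard unit vector. An objective $n$-skeleton ${\mathcal T}_n$ arising from ${\mathcal Z}_1,\dots,{\mathcal Z}_n$ consists of a map $W:\{0,1\}^n\to{\mathcal B}$ (not necessarily injective) together with an assignment, to each $X_I$-edge $v\to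 v+e_I$, of an arrow (its weight) $g_{v,I}\in{\mathcal Z}_I$ with source $W(v)$ and target $W(v+e_I)$. Vertices of ${\mathcal T}_n$ corresponding to different vertices of $S_n$ are regarded as different entries, even if they coincide as points of $\mathcal B$. A 2-face of ${\mathcal T}_n$ is determined by distinct indices $I,J$ and a vertex $v$ with $v_I=v_J=0$, and has vertices $v,\ v+e_I,\ v+e_J,\ v+e_I+e_J$. It is commutative if $g_{v+e_I,J}\circ g_{v,I}=g_{v+e_J,I}\circ g_{v,J}$ in the 1-jet groupoid. A path in ${\mathcal T}_n$ is a finite sequence of successively adjacent edges of the graph, where edges may be traversed along or against their orientation. The weight contributed by an edge traversed against its orientation is the inverse of its weight. The total weight (or length) of a path is the composition, in the order of traversal, of the contributed weights in the 1-jet groupoid. A circuit is a path whose first and last vertices coincide as vertices of the graph. *)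

(* Defs.v *)
From HB Require Import structures.
From mathcomp Require Import all_boot all_order all_algebra.
From mathcomp Require Import all_classical all_reals all_analysis.
Set Implicit Arguments.
Unset Strict Implicit.
Unset Printing Implicit Defensive.
Import Order.TTheory GRing.Theory Num.Theory numFieldNormedType.Exports.
Local Open Scope quotient_scope.
Local Open Scope classical_set_scope.
Local Open Scope ring_scope.

(* Only meaningful on an open set U: the directional derivatives of f at a point
   of U see f on a neighbourhood of that point. *)
Fixpoint Ck (R : realType) (V W : normedModType R) (k : nat) (U : set V)
    (f : V -> W) : Prop :=
  match k with
  | 0%N => forall x, U x -> {for x, continuous f}
  | k'.+1 => (forall x, U x -> differentiable f x) /\
             (forall v, Ck k' U (fun x => 'D_v f x))
  end.

Definition smooth_on (R : realType) (V W : normedModType R) (U : set V)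
  (f : V -> W) : Prop := forall k, Ck k U f.

Section CkTheory.
Variables (R : realType) (V : normedModType R).

Lemma Ck_pw (W : normedModType R) k (U : set V) (f : V -> W) :
  (forall x, U x -> Ck k [set x] f) -> Ck k U f.
Proof.
elim: k f => [|k IH] f h /=; first by move=> x Ux; apply: (h x Ux).
split=> [x Ux|v]; first by case: (h x Ux) => + _; apply.
by apply: IH => x Ux; case: (h x Ux) => _; apply.
Qed.

Lemma Ck_sub (W : normedModType R) k (U U' : set V) (f : V -> W) :
  U `<=` U' -> Ck k U' f -> Ck k U f.
Proof.
move=> sU; elim: k f => [|k IH] f /=; first by move=> h x /sU; apply: h.
by move=> [h1 h2]; split=> [x /sU/h1|v] //; apply: IH.
Qed.

Lemma near_eq_differentiable (W : normedModType R) (f g : V -> W) x :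
  (\forall y \near x, f y = g y) -> differentiable f x -> differentiable g x.
Proof.
move=> fg df; have [dc dl] := (diff_locallyP x f).1 df.
have gl : g \o shift x = cst (g x) + 'd f x +o_0 id.
  move/eqaddoP: dl => dl; apply/eqaddoP => e e0.
  have gx := nbhs_singleton fg.
  have fg0 : \forall h \near (0 : V), f (h + x) = g (h + x).
    by move: fg; rewrite (near_shift 0 x) subr0.
  have {}dl := dl e e0.
  apply: (filterS2 _ _ dl fg0) => h + fh.
  by rewrite !fctE /= -gx -fh.
by apply/diff_locallyP; rewrite (diff_unique dc gl).
Qed.

Lemma Ck_eq (W : normedModType R) k (U : set V) (f g : V -> W) :
  open U -> (forall x, U x -> f x = g x) -> Ck k U f -> Ck k U g.
Proof.
move=> oU; elim: k f g => [|k IH] f g fg /=.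
  move=> h x Ux; have := h x Ux.
  rewrite /prop_for /continuous_at -(fg _ Ux); apply: cvg_trans.
  apply: near_eq_cvg; near=> y; apply: fg; near: y.
  exact: open_nbhs_nbhs.
move=> [h1 h2]; split=> [x Ux|v].
  have nfg : \forall y \near x, f y = g y.
    by near=> y; apply: fg; near: y; exact: open_nbhs_nbhs.
  exact: near_eq_differentiable nfg (h1 x Ux).
apply: IH (h2 v) => x Ux; apply: near_eq_derive.
by near=> y; apply: fg; near: y; exact: open_nbhs_nbhs.
Unshelve. all: by end_near.
Qed.

Lemma Ck_le (W : normedModType R) k (U : set V) (f : V -> W) :
  Ck k.+1 U f -> Ck k U f.
Proof.
elim: k f => [|k IH] f [h1 h2].
  by move=> x /h1; apply: differentiable_continuous.
by split => // v; apply: IH; apply: h2.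
Qed.

Lemma Ck_cst (W : normedModType R) k (U : set V) (a : W) : Ck k U (cst a).
Proof.
elim: k a => [|k IH] a /=; first by move=> x _; exact: cst_continuous.
split=> [x _|v]; first exact: differentiable_cst.
by rewrite (_ : (fun _ => _) = cst 0) //; apply/funext => x; rewrite derive_cst.
Qed.

Lemma Ck_add (W : normedModType R) k (U : set V) (f g : V -> W) : open U ->
  Ck k U f -> Ck k U g -> Ck k U (f \+ g).
Proof.
move=> oU; elim: k f g => [|k IH] f g.
  by move=> hf hg x Ux; apply: continuousD; [apply: hf|apply: hg].
move=> [f1 f2] [g1 g2]; split=> [x Ux|v].
  by apply: differentiableD; auto.
apply: (@Ck_eq _ _ _ ((fun x => 'D_v f x) \+ (fun x => 'D_v g x))) => //.
  by move=> x Ux /=; rewrite deriveD //; apply: diff_derivable; auto.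
by apply: IH; [exact: f2|exact: g2].
Qed.

Lemma Ck_mul k (U : set V) (f g : V -> R) : open U ->
  Ck k U f -> Ck k U g -> Ck k U (f \* g).
Proof.
move=> oU; elim: k f g => [|k IH] f g hf hg.
  by move=> x Ux; apply: continuousM; [apply: hf|apply: hg].
have [[f1 f2] [g1 g2]] := (hf, hg); split=> [x Ux|v].
  by apply: differentiableM; auto.
apply: (@Ck_eq _ _ _ ((f \* (fun x => 'D_v g x)) \+ (g \* (fun x => 'D_v f x)))) => //.
  by move=> x Ux /=; rewrite deriveM //; apply: diff_derivable; auto.
by apply: Ck_add => //; apply: IH; [exact: Ck_le|exact: g2|exact: Ck_le|exact: f2].
Qed.

Lemma Ck_sum (W : normedModType R) n k (U : set V) (f : 'I_n -> V -> W) :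
  open U -> (forall i, Ck k U (f i)) -> Ck k U (fun x => \sum_i f i x).
Proof.
move=> oU hf; elim: (index_enum _) => [|i s IH].
  by rewrite (_ : (fun _ => _) = cst 0);
    [exact: Ck_cst|apply/funext => x; rewrite big_nil].
rewrite (_ : (fun _ => _) = (f i \+ (fun x => \sum_(j <- s) f j x))).
  by apply: Ck_add => //; exact: hf.
by apply/funext => x; rewrite big_cons.
Qed.

Lemma Ck_coord n k (U : set V) (f : V -> 'rV[R]_n) j : open U ->
  Ck k U f -> Ck k U (fun x => f x 0 j).
Proof.
move=> oU; elim: k f => [|k IH] f.
  move=> hf x Ux; apply: (@continuous_comp _ _ _ f (fun M : 'rV[R]_n => M 0 j)).
    exact: hf.
  exact: coord_continuous.
move=> [f1 f2]; split=> [x Ux|v].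
  apply: (@differentiable_comp _ _ _ _ f (fun M : 'rV[R]_n => M 0 j)); first exact: f1.
  exact: differentiable_coord.
apply: (@Ck_eq _ _ _ (fun x => 'D_v f x 0 j)) => //; last by apply: IH; exact: f2.
by move=> x Ux; rewrite derive_mx ?mxE //; apply: diff_derivable; auto.
Qed.

Lemma Ck_row n k (U : set V) (f : V -> 'rV[R]_n) : open U ->
  (forall j, Ck k U (fun x => f x 0 j)) -> Ck k U f.
Proof.
move=> oU; elim: k f => [|k IH] f hf.
  move=> x Ux; rewrite (_ : f = fun y => \sum_j (f y 0 j *: 'e_j)); last first.
    by apply/funext => y; rewrite -row_sum_delta.
  apply: (@Ck_sum _ _ 0%N U (fun j y => f y 0 j *: 'e_j)) Ux => // j y Uy.
  by apply: continuousZr_tmp; apply: hf.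
have df x : U x -> differentiable f x.
  move=> Ux; rewrite (_ : f = \sum_j (fun y => f y 0 j *: 'e_j)); last first.
    by apply/funext => y; rewrite fct_sumE -row_sum_delta.
  apply: differentiable_sum => j; apply: differentiableZl.
  by case: (hf j) => + _; apply.
split=> // v; apply: IH => j; case: (hf j) => _ /(_ v).
apply: Ck_eq => // x Ux; rewrite derive_mx ?mxE //.
by apply: diff_derivable; auto.
Qed.

Lemma derive_comp_coord m (f : V -> 'rV[R]_m) (g : 'rV[R]_m -> R) x v :
  differentiable f x -> differentiable g (f x) ->
  'D_v (g \o f) x = \sum_j ('D_v f x 0 j * 'D_('e_j) g (f x)).
Proof.
move=> df dg; rewrite !deriveE //; last exact: differentiable_comp.
rewrite diff_comp //= [in LHS](row_sum_delta ('d f x v)) linear_sum.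
by apply: eq_bigr => j _; rewrite linearZ deriveE.
Qed.

Lemma Ck_comp_scalar m k (U : set V) (U' : set 'rV[R]_m) (f : V -> 'rV[R]_m)
    (g : 'rV[R]_m -> R) : open U -> (forall x, U x -> U' (f x)) ->
  Ck k U f -> Ck k U' g -> Ck k U (g \o f).
Proof.
move=> oU fU; elim: k g => [|k IH] g hf hg.
  by move=> x Ux; apply: continuous_comp; [apply: hf|apply: hg; apply: fU].
have [[f1 f2] [g1 g2]] := (hf, hg); split=> [x Ux|v].
  by apply: differentiable_comp; [apply: f1|apply: g1; apply: fU].
apply: (@Ck_eq _ _ _ (fun x => \sum_j ('D_v f x 0 j * 'D_('e_j) g (f x)))) => //.
  by move=> x Ux; rewrite -derive_comp_coord //; [apply: f1|apply: g1; apply: fU].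
apply: (@Ck_sum _ _ _ U (fun j x => 'D_v f x 0 j * 'D_('e_j) g (f x))) => // j.
apply: (@Ck_mul _ _ (fun x => 'D_v f x 0 j) ((fun y => 'D_('e_j) g y) \o f)) => //.
  by apply: (@Ck_coord _ _ _ (fun x => 'D_v f x)) => //; exact: f2.
by apply: IH; [exact: Ck_le|exact: g2].
Qed.

End CkTheory.

Lemma smooth_comp (R : realType) (V : normedModType R) m n (U : set V) (U' : set 'rV[R]_m) (f : V -> 'rV[R]_m)
    (g : 'rV[R]_m -> 'rV[R]_n) : open U -> open U' ->
  (forall x, U x -> U' (f x)) ->
  smooth_on U f -> smooth_on U' g -> smooth_on U (g \o f).
Proof.
move=> oU oU' fU hf hg k; apply: Ck_row => // j.
apply: (@Ck_comp_scalar _ _ _ _ _ U' _ (fun y => g y 0 j)) => //.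
by apply: Ck_coord => //; exact: hg.
Qed.


Section LocalSmooth.
Variables (R : realType) (V W : normedModType R).

Lemma smooth_on_local (U : set V) (f : V -> W) :
  (forall x, U x -> exists N : set V, N x /\ smooth_on N f) -> smooth_on U f.
Proof.
move=> h k; apply: Ck_pw => x /h[N [Nx sN]].
by apply: Ck_sub (sN k) => _ ->.
Qed.

Lemma smooth_on_differentiable (U : set V) (f : V -> W) x :
  smooth_on U f -> U x -> differentiable f x.
Proof. by move=> /(_ 1%N) [+ _]; apply. Qed.

Lemma smooth_on_eq (U : set V) (f g : V -> W) : open U ->
  (forall x, U x -> f x = g x) -> smooth_on U f -> smooth_on U g.
Proof. by move=> oU fg sf k; apply: Ck_eq (sf k). Qed.

Lemma near_eq_diff (f g : V -> W) x : differentiable f x ->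
  (\forall y \near x, f y = g y) -> 'd f x = 'd g x :> (V -> W).
Proof.
move=> df fg; apply/funext => v.
rewrite -!deriveE ?(near_eq_derive _ fg) //.
exact: near_eq_differentiable fg df.
Qed.

End LocalSmooth.

Record chart (R : realType) (T : topologicalType) := Chart {
  chart_dom : set T;
  chart_fun :> T -> 'rV[R]_3;
  chart_inv : 'rV[R]_3 -> T;
  chart_dom_open : open chart_dom;
  chart_img_open : open (chart_fun @` chart_dom);
  chart_funK : forall x, chart_dom x -> chart_inv (chart_fun x) = x;
  chart_fun_continuous : forall x, chart_dom x -> {for x, continuous chart_fun};
  chart_inv_continuous : forall y, (chart_fun @` chart_dom) y ->
    {for y, continuous chart_inv} }.

Record body_manifold (R : realType) := BodyManifold {
  body_carrier :> topologicalType;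
  body_hausdorff : hausdorff_space body_carrier;
  body_second_countable : @second_countable body_carrier;
  atlas : set (chart R body_carrier);
  atlas_cover : forall X, exists2 phi, atlas phi & chart_dom phi X;
  atlas_smooth : forall phi psi, atlas phi -> atlas psi ->
    smooth_on (phi @` (chart_dom phi `&` chart_dom psi)) (psi \o chart_inv phi) }.

Definition local_rep (R : realType) (B : body_manifold R) (phi psi : chart R B)
  (f : B -> B) : 'rV[R]_3 -> 'rV[R]_3 := psi \o f \o chart_inv phi.

Definition body_smooth_on (R : realType) (B : body_manifold R) (U : set B)
    (f : B -> B) : Prop :=
  (forall X, U X -> {for X, continuous f}) /\
  (forall phi psi, atlas phi -> atlas psi ->
    smooth_on (phi @` (U `&` chart_dom phi `&` f @^-1` chart_dom psi))
              (local_rep phi psi f)).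

(* The total maps are only relevant on the open sets [ld_source] and
   [ld_target]. *)
Record local_diffeo (R : realType) (B : body_manifold R) (X Y : B) :=
  LocalDiffeo {
  ld_source : set B;
  ld_target : set B;
  ld_fun :> B -> B;
  ld_inv : B -> B;
  ld_source_open : open ld_source;
  ld_target_open : open ld_target;
  ld_fun_target : forall P, ld_source P -> ld_target (ld_fun P);
  ld_inv_source : forall Q, ld_target Q -> ld_source (ld_inv Q);
  ld_funK : forall P, ld_source P -> ld_inv (ld_fun P) = P;
  ld_invK : forall Q, ld_target Q -> ld_fun (ld_inv Q) = Q;
  ld_fun_smooth : body_smooth_on ld_source ld_fun;
  ld_inv_smooth : body_smooth_on ld_target ld_inv;
  ld_base : ld_source X;
  ld_fun_base : ld_fun X = Y }.

HB.instance Definition _ (R : realType) (B : body_manifold R) (X Y : B) :=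
  gen_eqMixin (local_diffeo X Y).
HB.instance Definition _ (R : realType) (B : body_manifold R) (X Y : B) :=
  gen_choiceMixin (local_diffeo X Y).

(* Equality for one pair of charts around X and Y already implies it for all. *)
Definition same_jet (R : realType) (B : body_manifold R) (X Y : B)
    (f g : local_diffeo X Y) : Prop :=
  forall phi psi, atlas phi -> atlas psi -> chart_dom phi X -> chart_dom psi Y ->
    'd (local_rep phi psi f) (phi X) = 'd (local_rep phi psi g) (phi X)
      :> ('rV[R]_3 -> 'rV[R]_3).

Section LocalDiffeo.
Variables (R : realType) (B : body_manifold R).
Implicit Types (phi psi chi : chart R B) (X Y Z : B).

Lemma chart_image_open phi (U : set B) : open U -> U `<=` chart_dom phi ->
  open (phi @` U).
Proof.
move=> oU sU; rewrite openE => _ [x Ux <-].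
have dx := sU x Ux.
have ix : (phi @` chart_dom phi) (phi x) by exists x.
have h1 : \forall z \near phi x, (phi @` chart_dom phi) z.
  by apply: open_nbhs_nbhs; split => //; exact: chart_img_open.
have h2 : \forall z \near phi x, U (chart_inv phi z).
  have := @chart_inv_continuous _ _ phi _ ix.
  rewrite /prop_for /continuous_at chart_funK //; apply.
  exact: open_nbhs_nbhs.
apply: filterS2 h1 h2 => z [y dy <-]; rewrite chart_funK //.
Qed.

Lemma preimage_open_on (U V : set B) (f : B -> B) : open U -> open V ->
  (forall X, U X -> {for X, continuous f}) -> open (U `&` f @^-1` V).
Proof.
move=> oU oV cf; rewrite openE => x [Ux Vfx].
have h1 : nbhs x U by exact: open_nbhs_nbhs.
have h2 : nbhs x (f @^-1` V) by apply: cf => //; exact: open_nbhs_nbhs.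
exact: filterI.
Qed.

Lemma rep_dom_open phi psi (U : set B) (f : B -> B) : open U ->
  (forall X, U X -> {for X, continuous f}) ->
  open (phi @` (U `&` chart_dom phi `&` f @^-1` chart_dom psi)).
Proof.
move=> oU cf; apply: chart_image_open; last by move=> x [[]].
apply: preimage_open_on; [|exact: chart_dom_open|by move=> x []; auto].
by apply: openI => //; exact: chart_dom_open.
Qed.

Lemma body_smooth_id (U : set B) : open U -> body_smooth_on U id.
Proof.
move=> oU; split=> [X _|phi psi aphi apsi]; first exact: cvg_id.
move=> k; apply: Ck_sub (atlas_smooth aphi apsi k).
by move=> _ [x [[_ ?] ?] <-]; exists x.
Qed.

Lemma local_rep_comp phi psi chi (U U' : set B) (f g : B -> B) :
  open U -> open U' -> body_smooth_on U f -> body_smooth_on U' g ->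
  exists N : set 'rV[R]_3, [/\ open N,
    (forall X, U X -> U' (f X) -> chart_dom phi X -> chart_dom chi (f X) ->
      chart_dom psi (g (f X)) -> N (phi X)),
    (forall y, N y -> local_rep phi psi (g \o f) y =
       (local_rep chi psi g \o local_rep phi chi f) y),
    (forall y, N y ->
       (phi @` (U `&` chart_dom phi `&` f @^-1` chart_dom chi)) y) &
    (forall y, N y ->
       (chi @` (U' `&` chart_dom chi `&` g @^-1` chart_dom psi))
         (local_rep phi chi f y))].
Proof.
move=> oU oU' [cf sf] [cg sg].
set V := U' `&` chart_dom chi `&` g @^-1` chart_dom psi.
have oV : open V.
  apply: preimage_open_on; [|exact: chart_dom_open|by move=> x []; auto].
  by apply: openI => //; exact: chart_dom_open.
exists (phi @` (U `&` chart_dom phi `&` f @^-1` V)); split.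
- apply: chart_image_open; last by move=> x [[]].
  apply: preimage_open_on => //; last by move=> x []; auto.
  by apply: openI => //; exact: chart_dom_open.
- by move=> X *; exists X.
- move=> _ [x [[Ux dx] [[? ?] ?]] <-].
  by rewrite /local_rep /= chart_funK // chart_funK.
- by move=> _ [x [[Ux dx] [[? ?] ?]] <-]; exists x.
- move=> _ [x [[Ux dx] Vx] <-]; exists (f x) => //.
  by rewrite /local_rep /= chart_funK.
Qed.

Lemma body_smooth_comp (U U' : set B) (f g : B -> B) : open U -> open U' ->
  body_smooth_on U f -> body_smooth_on U' g ->
  body_smooth_on (U `&` f @^-1` U') (g \o f).
Proof.
move=> oU oU' hf hg; have [[cf sf] [cg sg]] := (hf, hg); split.
  by move=> X [UX U'fX]; apply: continuous_comp; [apply: cf|apply: cg].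
move=> phi psi aphi apsi; apply: smooth_on_local => _ [X [[[UX U'X] dX] dgX] <-].
have [chi achi dchi] := atlas_cover (f X).
have [N [oN NX Neq Nf Ng]] := local_rep_comp phi psi chi oU oU' hf hg.
exists N; split; first exact: NX.
apply: (@smooth_on_eq _ _ _ _ (local_rep chi psi g \o local_rep phi chi f)) => //.
  by move=> y /Neq.
apply: (@smooth_comp _ _ _ _ N _ _ _ oN _ Ng).
- exact: rep_dom_open.
- by move=> k; apply: Ck_sub (sf _ _ aphi achi k).
- exact: sg.
Qed.

Lemma diff_local_rep_comp phi psi chi (U U' : set B) (f g : B -> B) X :
  atlas phi -> atlas psi -> atlas chi ->
  open U -> open U' -> body_smooth_on U f -> body_smooth_on U' g ->
  U X -> U' (f X) -> chart_dom phi X -> chart_dom chi (f X) ->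
  chart_dom psi (g (f X)) ->
  'd (local_rep phi psi (g \o f)) (phi X) =
  'd (local_rep chi psi g) (chi (f X)) \o 'd (local_rep phi chi f) (phi X)
    :> ('rV[R]_3 -> 'rV[R]_3).
Proof.
move=> aphi apsi achi oU oU' hf hg UX U'X dX dfX dgX.
have [N [oN NX Neq Nf Ng]] := local_rep_comp phi psi chi oU oU' hf hg.
have {}NX : N (phi X) by exact: NX.
have df : differentiable (local_rep phi chi f) (phi X).
  by apply: smooth_on_differentiable (hf.2 _ _ aphi achi) _; exact: Nf.
have fX : local_rep phi chi f (phi X) = chi (f X).
  by rewrite /local_rep /= chart_funK.
have dg : differentiable (local_rep chi psi g) (local_rep phi chi f (phi X)).
  by apply: smooth_on_differentiable (hg.2 _ _ achi apsi) _; exact: Ng.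
have dgf := diff_comp df dg.
rewrite fX in dgf; rewrite -{}dgf; apply/esym.
apply: near_eq_diff; first exact: differentiable_comp.
apply: filterS (open_nbhs_nbhs (conj oN NX)) => y Ny.
by rewrite Neq.
Qed.

Lemma diff_local_rep_id phi (U : set B) (f : B -> B) X :
  open U -> U X -> chart_dom phi X -> (forall P, U P -> f P = P) ->
  'd (local_rep phi phi f) (phi X) = id :> ('rV[R]_3 -> 'rV[R]_3).
Proof.
move=> oU UX dX fid.
have did : is_diff (phi X) (@id 'rV[R]_3) id by exact: is_diff_id.
apply: (etrans _ (@diff_val _ _ _ _ _ _ _ did)); apply/esym.
apply: near_eq_diff; first exact: ex_diff.
have oN : open (phi @` (U `&` chart_dom phi)).
  apply: chart_image_open; last by move=> ? [].
  by apply: openI => //; exact: chart_dom_open.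
have Nx : (phi @` (U `&` chart_dom phi)) (phi X) by exists X.
apply: filterS (open_nbhs_nbhs (conj oN Nx)) => _ [x [Ux dx] <-].
by rewrite /local_rep /= chart_funK // fid.
Qed.

Lemma ld_id_subproof X : body_smooth_on [set: B] id.
Proof. by apply: body_smooth_id; exact: openT. Qed.

Definition ld_id X : local_diffeo X X :=
  @LocalDiffeo R B X X setT setT id id openT openT (fun _ h => h) (fun _ h => h)
    (fun _ _ => erefl) (fun _ _ => erefl) (ld_id_subproof X) (ld_id_subproof X)
    Logic.I erefl.

Lemma ld_inv_base X Y (f : local_diffeo X Y) : ld_inv f Y = X.
Proof. by have := ld_funK (ld_base f); rewrite ld_fun_base. Qed.

Lemma ld_target_base X Y (f : local_diffeo X Y) : ld_target f Y.
Proof. by have := ld_fun_target (ld_base f); rewrite ld_fun_base. Qed.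

Definition ld_sym X Y (f : local_diffeo X Y) : local_diffeo Y X :=
  @LocalDiffeo R B Y X (ld_target f) (ld_source f) (ld_inv f) f
    (ld_target_open f) (ld_source_open f) (@ld_inv_source _ _ _ _ f)
    (@ld_fun_target _ _ _ _ f) (@ld_invK _ _ _ _ f) (@ld_funK _ _ _ _ f)
    (ld_inv_smooth f) (ld_fun_smooth f) (ld_target_base f) (ld_inv_base f).

Definition ld_comp X Y Z (g : local_diffeo Y Z) (f : local_diffeo X Y) :
  local_diffeo X Z.
Proof.
apply: (@LocalDiffeo R B X Z (ld_source f `&` f @^-1` ld_source g)
  (ld_target g `&` ld_inv g @^-1` ld_target f) (g \o f) (ld_inv f \o ld_inv g)).
- by apply: preimage_open_on; [exact: ld_source_open..|case: (ld_fun_smooth f)].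
- by apply: preimage_open_on; [exact: ld_target_open..|case: (ld_inv_smooth g)].
- move=> P [sP sfP]; split; first exact: ld_fun_target.
  by rewrite /preimage /= ld_funK //; exact: ld_fun_target.
- move=> Q [tQ tgQ]; split; first exact: ld_inv_source.
  by rewrite /preimage /= ld_invK //; exact: ld_inv_source.
- by move=> P [sP sfP] /=; rewrite ld_funK // ld_funK.
- by move=> Q [tQ tgQ] /=; rewrite ld_invK // ld_invK.
- apply: body_smooth_comp; [exact: ld_source_open..| |]; exact: ld_fun_smooth.
- apply: body_smooth_comp; [exact: ld_target_open..| |]; exact: ld_inv_smooth.
- by split; [exact: ld_base|rewrite /preimage /= ld_fun_base; exact: ld_base].
- by rewrite /= !ld_fun_base.
Defined.

Lemma diff_ld_comp X Y Z (g : local_diffeo Y Z) (f : local_diffeo X Y)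
    phi psi chi : atlas phi -> atlas psi -> atlas chi ->
  chart_dom phi X -> chart_dom chi Y -> chart_dom psi Z ->
  'd (local_rep phi psi (g \o f)) (phi X) =
  'd (local_rep chi psi g) (chi Y) \o 'd (local_rep phi chi f) (phi X)
    :> ('rV[R]_3 -> 'rV[R]_3).
Proof.
move=> aphi apsi achi dX dY dZ.
have h := @diff_local_rep_comp phi psi chi _ _ f g X aphi apsi achi
  (ld_source_open f) (ld_source_open g) (ld_fun_smooth f) (ld_fun_smooth g)
  (ld_base f).
by rewrite !ld_fun_base in h; apply: h => //; exact: ld_base.
Qed.

Lemma same_jet_refl X Y (f : local_diffeo X Y) : same_jet f f.
Proof. by []. Qed.

Lemma same_jet_sym X Y (f g : local_diffeo X Y) : same_jet f g -> same_jet g f.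
Proof. by move=> fg phi psi a b c d; exact (esym (fg _ _ a b c d)). Qed.

Lemma same_jet_trans X Y (f g h : local_diffeo X Y) :
  same_jet f g -> same_jet g h -> same_jet f h.
Proof.
move=> fg gh phi psi a b c d; exact (etrans (fg _ _ a b c d) (gh _ _ a b c d)).
Qed.

Lemma same_jet_comp X Y Z (g g' : local_diffeo Y Z) (f f' : local_diffeo X Y) :
  same_jet g g' -> same_jet f f' -> same_jet (ld_comp g f) (ld_comp g' f').
Proof.
move=> gg ff phi psi aphi apsi dX dZ.
have [chi achi dY] := atlas_cover Y.
apply: etrans (diff_ld_comp g f aphi apsi achi dX dY dZ) _.
apply: etrans (esym (diff_ld_comp g' f' aphi apsi achi dX dY dZ)).
exact (congr2 comp (gg _ _ achi apsi dY dZ) (ff _ _ aphi achi dX dY)).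
Qed.

Lemma ld_compVf X Y (f : local_diffeo X Y) :
  same_jet (ld_comp (ld_sym f) f) (ld_id X).
Proof.
move=> phi psi aphi apsi dX dX'.
apply: near_eq_diff.
  have [sm bX] := (ld_fun_smooth (ld_comp (ld_sym f) f),
                   ld_base (ld_comp (ld_sym f) f)).
  apply: smooth_on_differentiable (sm.2 _ _ aphi apsi) _.
  exists X => //; split; first by split.
  by rewrite /preimage /= ld_fun_base ld_inv_base.
have oN : open (phi @` (ld_source f `&` chart_dom phi)).
  apply: chart_image_open; last by move=> ? [].
  by apply: openI; [exact: ld_source_open|exact: chart_dom_open].
have Nx : (phi @` (ld_source f `&` chart_dom phi)) (phi X).
  by exists X => //; split => //; exact: ld_base.
apply: filterS (open_nbhs_nbhs (conj oN Nx)) => _ [x [Ux dx] <-].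
by rewrite /local_rep /= chart_funK // ld_funK.
Qed.

Lemma ld_compfV X Y (f : local_diffeo X Y) :
  same_jet (ld_comp f (ld_sym f)) (ld_id Y).
Proof. exact: (ld_compVf (ld_sym f)). Qed.

Lemma same_jet_ld_sym X Y (f g : local_diffeo X Y) :
  same_jet f g -> same_jet (ld_sym f) (ld_sym g).
Proof.
move=> fg.
apply: (@same_jet_trans _ _ _ (ld_comp (ld_sym f) (ld_comp g (ld_sym g)))).
  have h := same_jet_comp (@same_jet_refl _ _ (ld_sym f)) (ld_compfV g).
  exact (same_jet_sym h).
have h := same_jet_comp (same_jet_comp (@same_jet_refl _ _ (ld_sym f))
  (same_jet_sym fg)) (@same_jet_refl _ _ (ld_sym g)).
apply: (same_jet_trans h).
exact (same_jet_comp (ld_compVf f) (@same_jet_refl _ _ (ld_sym g))).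
Qed.

Definition jet_rel X Y : rel (local_diffeo X Y) :=
  fun f g => `[< same_jet f g >].

Lemma jet_rel_refl X Y : reflexive (@jet_rel X Y).
Proof. by move=> f; apply/asboolP. Qed.

Lemma jet_rel_sym X Y : symmetric (@jet_rel X Y).
Proof. by move=> f g; apply/asboolP/asboolP => h; exact (same_jet_sym h). Qed.

Lemma jet_rel_trans X Y : transitive (@jet_rel X Y).
Proof.
move=> g f h /asboolP fg /asboolP gh; apply/asboolP.
exact (same_jet_trans fg gh).
Qed.

Canonical jet_equiv X Y :=
  EquivRel (@jet_rel X Y) (@jet_rel_refl X Y) (@jet_rel_sym X Y)
    (@jet_rel_trans X Y).

Definition jet X Y : Type := {eq_quot (jet_equiv X Y)}.

Definition jet_of X Y (f : local_diffeo X Y) : jet X Y :=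
  \pi_({eq_quot (jet_equiv X Y)}) f.

Definition jet_repr X Y (a : jet X Y) : local_diffeo X Y :=
  repr (a : {eq_quot (jet_equiv X Y)}).

Lemma jet_reprK X Y (a : jet X Y) : jet_of (jet_repr a) = a.
Proof. exact: reprK. Qed.

Lemma jet_ofP X Y (f g : local_diffeo X Y) :
  jet_of f = jet_of g <-> same_jet f g.
Proof.
split=> [/(@eqmodP _ (jet_equiv X Y))/asboolP //|h].
by apply/(@eqmodP _ (jet_equiv X Y))/asboolP.
Qed.

Definition jet_id X : jet X X := jet_of (ld_id X).

Definition jet_comp X Y Z (b : jet Y Z) (a : jet X Y) : jet X Z :=
  jet_of (ld_comp (jet_repr b) (jet_repr a)).

Definition jet_inv X Y (a : jet X Y) : jet Y X := jet_of (ld_sym (jet_repr a)).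

Lemma jet_compE X Y Z (g : local_diffeo Y Z) (f : local_diffeo X Y) :
  jet_comp (jet_of g) (jet_of f) = jet_of (ld_comp g f).
Proof.
by apply/jet_ofP/same_jet_comp; apply/jet_ofP; rewrite jet_reprK.
Qed.

Lemma jet_invE X Y (f : local_diffeo X Y) :
  jet_inv (jet_of f) = jet_of (ld_sym f).
Proof. by apply/jet_ofP/same_jet_ld_sym/jet_ofP; rewrite jet_reprK. Qed.

Lemma jet_compA X Y Z P (c : jet Z P) (b : jet Y Z) (a : jet X Y) :
  jet_comp c (jet_comp b a) = jet_comp (jet_comp c b) a.
Proof.
rewrite -(jet_reprK a) -(jet_reprK b) -(jet_reprK c) !jet_compE.
by apply/jet_ofP.
Qed.

Lemma jet_comp1f X Y (a : jet X Y) : jet_comp (jet_id Y) a = a.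
Proof. by rewrite -(jet_reprK a) jet_compE; apply/jet_ofP. Qed.

Lemma jet_compf1 X Y (a : jet X Y) : jet_comp a (jet_id X) = a.
Proof. by rewrite -(jet_reprK a) jet_compE; apply/jet_ofP. Qed.

Lemma jet_compVf X Y (a : jet X Y) : jet_comp (jet_inv a) a = jet_id X.
Proof.
rewrite -(jet_reprK a) jet_invE jet_compE; apply/jet_ofP.
exact: ld_compVf.
Qed.

Lemma jet_compfV X Y (a : jet X Y) : jet_comp a (jet_inv a) = jet_id Y.
Proof.
rewrite -(jet_reprK a) jet_invE jet_compE; apply/jet_ofP.
exact: ld_compfV.
Qed.

End LocalDiffeo.

Record groupoid := Groupoid {
  obj :> Type;
  arrow : obj -> obj -> Type;
  gid : forall X, arrow X X;
  gcomp : forall X Y Z, arrow Y Z -> arrow X Y -> arrow X Z;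
  ginv : forall X Y, arrow X Y -> arrow Y X;
  gcompA : forall X Y Z P (c : arrow Z P) (b : arrow Y Z) (a : arrow X Y),
    gcomp c (gcomp b a) = gcomp (gcomp c b) a;
  gcomp1f : forall X Y (a : arrow X Y), gcomp (gid Y) a = a;
  gcompf1 : forall X Y (a : arrow X Y), gcomp a (gid X) = a;
  gcompVf : forall X Y (a : arrow X Y), gcomp (ginv a) a = gid X;
  gcompfV : forall X Y (a : arrow X Y), gcomp a (ginv a) = gid Y }.

Definition jet_groupoid (R : realType) (B : body_manifold R) : groupoid :=
  @Groupoid B (@jet R B) (@jet_id R B) (@jet_comp R B) (@jet_inv R B)
    (@jet_compA R B) (@jet_comp1f R B) (@jet_compf1 R B) (@jet_compVf R B)
    (@jet_compfV R B).

(* Subgroupoids are wide: they have the same objects as the ambient groupoid. *)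
Record subgroupoid (G : groupoid) := Subgroupoid {
  sub_arrow : forall X Y : G, set (arrow X Y);
  sub_gid : forall X, sub_arrow (gid X);
  sub_gcomp : forall X Y Z (b : arrow Y Z) (a : arrow X Y),
    sub_arrow b -> sub_arrow a -> sub_arrow (gcomp b a);
  sub_ginv : forall X Y (a : arrow X Y),
    sub_arrow a -> sub_arrow (ginv a) }.

Definition vertex (n : nat) := {ffun 'I_n -> bool}.

(* This is v + e_I only when v I is 0, the one case used by [edge]. *)
Definition add_unit n (v : vertex n) (I : 'I_n) : vertex n :=
  [ffun i => (i == I) || v i].

Definition edge n (I : 'I_n) (v w : vertex n) : bool :=
  ~~ v I && (w == add_unit v I).

(* Weights are indexed by both endpoints of an edge together with a (boolean,
   hence proof-irrelevant) proof of adjacency, so that the four arrows around a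
   2-face compose without casts along v + e_I + e_J = v + e_J + e_I. *)
Record skeleton (G : groupoid) (n : nat) (Z : 'I_n -> subgroupoid G) :=
  Skeleton {
  skel_point :> vertex n -> G;
  weight : forall (I : 'I_n) (v w : vertex n), edge I v w ->
    arrow (skel_point v) (skel_point w);
  weightP : forall (I : 'I_n) (v w : vertex n) (e : edge I v w),
    sub_arrow (Z I) (weight e) }.

Definition commutative_2faces (G : groupoid) (n : nat)
    (Z : 'I_n -> subgroupoid G) (T : skeleton Z) : Prop :=
  forall (I J : 'I_n) (v vI vJ vIJ : vertex n)
    (e_v_vI : edge I v vI) (e_vI_vIJ : edge J vI vIJ)
    (e_v_vJ : edge J v vJ) (e_vJ_vIJ : edge I vJ vIJ),
  I != J ->
  gcomp (weight T e_vI_vIJ) (weight T e_v_vI) =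
  gcomp (weight T e_vJ_vIJ) (weight T e_v_vJ).

(* path_along and path_against prepend an edge traversed along, respectively
   against, its orientation. *)
Inductive skel_path (n : nat) : vertex n -> vertex n -> Type :=
| path_nil v : skel_path v v
| path_along I u v w : edge I u v -> skel_path v w -> skel_path u w
| path_against I u v w : edge I v u -> skel_path v w -> skel_path u w.

Fixpoint total_weight (G : groupoid) (n : nat) (Z : 'I_n -> subgroupoid G)
    (T : skeleton Z) (u w : vertex n) (p : skel_path u w) : arrow (T u) (T w) :=
  match p with
  | path_nil v => gid (T v)
  | path_along i u v w e q => gcomp (total_weight T q) (weight T e)
  | path_against i u v w e q => gcomp (total_weight T q) (ginv (weight T e))
  end.

(* Main.v *)
Require Import Defs.
From mathcomp Require Import all_boot all_order all_algebra.
From mathcomp Require Import all_classical all_reals all_analysis.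

(** A skeleton whose circuits are all trivial is one whose weights are the
    differences of a potential, and the potential can be built from the
    2-faces alone.  Take the all-ones vertex as base point.  An ascent at [v] is
    the total weight of some path from [v] to that top vertex running only along
    oriented edges.  Two ascents at [v] agree ([ascent_unique]): if they leave
    [v] by different edges, towards [v + e_I] and [v + e_J], both can be
    rerouted through [v + e_I + e_J], by induction on the number of zeros of
    the vertex, and the 2-face at [v] identifies the two detours.  This is the
    confluence argument for a terminating rewriting system.

    So each vertex carries exactly one ascent, and composing the ascent at the
    end of an arbitrary path with the weight of that path gives the ascent at
    its start ([ascent_total_weight]).  On a circuit both ascents are the same,
    and cancelling it leaves the identity.  Conversely the boundary of a 2-face
    is a circuit, whose triviality is the commutativity of the face. *)

Set Implicit Arguments.
Unset Strict Implicit.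
Unset Printing Implicit Defensive.

Section GroupoidCancellation.
Variable G : groupoid.
Implicit Types X Y W : G.

Lemma gcompfK X Y W (b : arrow Y W) (a : arrow X Y) :
  gcomp (gcomp b a) (ginv a) = b.
Proof. by rewrite -gcompA gcompfV gcompf1. Qed.

Lemma gcompVKf X Y W (b : arrow Y W) (a : arrow X Y) :
  gcomp (ginv b) (gcomp b a) = a.
Proof. by rewrite gcompA gcompVf gcomp1f. Qed.

End GroupoidCancellation.

Section Cube.
Variable n : nat.
Implicit Types (u v w : vertex n) (I J : 'I_n).

Definition top_vertex : vertex n := [ffun=> true].

Definition zeros v : nat := #|[pred i | ~~ v i]|.

Lemma edge_add_unit I v : ~~ v I -> edge I v (add_unit v I).
Proof. by move=> vI; rewrite /edge vI eqxx. Qed.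

Lemma edge_target I v w : edge I v w -> w = add_unit v I.
Proof. by case/andP=> _ /eqP. Qed.

Lemma edge_top I w : ~~ edge I top_vertex w.
Proof. by rewrite /edge ffunE. Qed.

Lemma exists_edge v : v != top_vertex -> exists I, edge I v (add_unit v I).
Proof.
move=> vtop; suff [I vI] : exists I, ~~ v I.
  by exists I; exact: edge_add_unit.
apply/existsP; rewrite -negb_forall; apply: contra vtop => /forallP v1.
by apply/eqP/ffunP => i; rewrite ffunE v1.
Qed.

Lemma zeros_edge I v w : edge I v w -> (zeros w < zeros v)%N.
Proof.
move=> e; have /andP[vI _] := e; rewrite (edge_target e).
apply/proper_card/properP; split.
  by apply/fintype.subsetP => i; rewrite !inE ffunE negb_or => /andP[].
by exists I; rewrite !inE // ffunE eqxx.
Qed.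

Lemma add_unit_commute v I J :
  add_unit (add_unit v I) J = add_unit (add_unit v J) I.
Proof. by apply/ffunP => i; rewrite !ffunE orbCA. Qed.

(** Closes a fork of two distinct edges into a 2-face. *)
Lemma edge_diamond I J v vI vJ : I != J -> edge I v vI -> edge J v vJ ->
  exists vIJ, edge J vI vIJ /\ edge I vJ vIJ.
Proof.
move=> IJ eI eJ; have [/andP[v0I _] /andP[v0J _]] := (eI, eJ).
rewrite (edge_target eI) (edge_target eJ).
exists (add_unit (add_unit v I) J); split.
  by apply: edge_add_unit; rewrite ffunE eq_sym (negPf IJ).
by rewrite add_unit_commute edge_add_unit // ffunE (negPf IJ).
Qed.

End Cube.

Section Ascent.
Variables (G : groupoid) (n : nat) (Z : 'I_n -> subgroupoid G).
Variable T : skeleton Z.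
Implicit Types (u v w : vertex n) (I J : 'I_n).

(** Kept as a relation: choosing one ascending path for each vertex would
    require transporting arrows along equalities between vertices. *)
Inductive ascent : forall v, arrow (T v) (T (top_vertex n)) -> Prop :=
| ascent_top : ascent (gid (T (top_vertex n)))
| ascent_along I v w (e : edge I v w) b :
    ascent b -> ascent (gcomp b (weight T e)).

Lemma ascent_ex v : exists a : arrow (T v) (T (top_vertex n)), ascent a.
Proof.
have [k] := ubnP (zeros v); elim: k v => // k IH v vk.
have [->|/exists_edge[I e]] := eqVneq v (top_vertex n).
  by exists (gid _); exact: ascent_top.
have [b bP] := IH _ (leq_trans (zeros_edge e) vk).
by exists (gcomp b (weight T e)); exact: ascent_along.
Qed.

(** The transport along [E] lets the case analysis keep [v] as a variable;
    vertices have decidable equality, so at the top itself [E] is trivial. *)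
Lemma ascent_at_top v (a : arrow (T v) (T (top_vertex n))) (E : top_vertex n = v) :
  ascent a ->
  a = eq_rect _ (fun w => arrow (T w) (T (top_vertex n))) (gid _) _ E.
Proof.
move=> aP; case: v a / aP E => [E|I v w e b _ E]; first by rewrite (eq_axiomK E).
by have /negP[] := edge_top I w; rewrite [X in edge _ X]E.
Qed.

Lemma ascent_inv v (a : arrow (T v) (T (top_vertex n))) :
  ascent a -> v != top_vertex n ->
  exists I w (e : edge I v w) b, ascent b /\ a = gcomp b (weight T e).
Proof. by case=> [|I u w e b bP _]; [rewrite eqxx | exists I, w, e, b]. Qed.

Hypothesis Tcomm : commutative_2faces T.

(** Confluence: edges leaving [v] in different directions are joined by a
    2-face, and the ascents beyond them are compared by induction. *)
Lemma ascent_unique v (a a' : arrow (T v) (T (top_vertex n))) :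
  ascent a -> ascent a' -> a = a'.
Proof.
have [k] := ubnP (zeros v); elim: k v a a' => // k IH v a a' vk aP a'P.
have [vtop|vtop] := eqVneq v (top_vertex n).
  by rewrite (ascent_at_top (esym vtop) aP) (ascent_at_top (esym vtop) a'P).
have [I [w [e [b [bP ->]]]]] := ascent_inv aP vtop.
have [J [w' [e' [b' [b'P ->]]]]] := ascent_inv a'P vtop.
have wk := leq_trans (zeros_edge e) vk; have w'k := leq_trans (zeros_edge e') vk.
have [IJ|IJ] := eqVneq I J.
  subst J; have ww' : w = w' by rewrite (edge_target e) (edge_target e').
  subst w'; rewrite (bool_irrelevance e e').
  by congr (gcomp _ _); exact: IH.
have [x [f f']] := edge_diamond IJ e e'.
have [c cP] := ascent_ex x.
rewrite (IH _ b _ wk bP (ascent_along f cP)).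
rewrite (IH _ b' _ w'k b'P (ascent_along f' cP)).
by rewrite -!gcompA (Tcomm e f e' f' IJ).
Qed.

(** An edge traversed backwards is where uniqueness enters: the ascent at its
    source must factor through it. *)
Lemma ascent_total_weight u w (p : skel_path u w) a :
  ascent a -> ascent (gcomp a (total_weight T p)).
Proof.
elim: p a => [v|I {}u v {}w e q IH|I {}u v {}w e q IH] a aP /=.
- by rewrite gcompf1.
- by rewrite gcompA; apply: ascent_along; exact: IH.
- have [b bP] := ascent_ex u; rewrite gcompA.
  by rewrite (ascent_unique (IH a aP) (ascent_along e bP)) gcompfK.
Qed.

Lemma circuit_trivial v (c : skel_path v v) : total_weight T c = gid (T v).
Proof.
have [a aP] := ascent_ex v.
rewrite -(gcompVKf a (total_weight T c)).
by rewrite (ascent_unique (ascent_total_weight c aP) aP) gcompVf.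
Qed.

End Ascent.

Lemma trivial_circuits_commutative (G : groupoid) (n : nat)
    (Z : 'I_n -> subgroupoid G) (T : skeleton Z) :
  (forall v (c : skel_path v v), total_weight T c = gid (T v)) ->
  commutative_2faces T.
Proof.
move=> Tc I J v vI vJ vIJ e1 e2 e3 e4 _.
have := Tc v (path_along e1 (path_along e2
  (path_against e4 (path_against e3 (path_nil v))))).
rewrite /= gcomp1f -!gcompA => /(congr1 (gcomp (weight T e3))).
rewrite gcompA gcompfV gcomp1f gcompf1 => /(congr1 (gcomp (weight T e4))).
by rewrite gcompA gcompfV gcomp1f.
Qed.

Theorem theorem4p1 (R : realType) (B : body_manifold R) (n : nat)
    (hn : (1 <= n)%N) (Z : 'I_n -> subgroupoid (jet_groupoid B))
    (T : skeleton Z) :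
  (forall (v : vertex n) (c : skel_path v v),
     total_weight T c = gid (T v)) <->
  commutative_2faces T.
Proof.
split; first exact: trivial_circuits_commutative.
by move=> Tcomm v c; exact: circuit_trivial.
Qed.
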